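(* Every unitary commutative Frobenius algebra is isomorphic to $\mathrm{Dim}\,H$ for some 2-Hilbert space $H$.
   Context: Inner products are linear in the second variable. An $H^*$-algebra is a finite-dimensional complex Hilbert space $A$ that is also an associative unital algebra, with an antilinear involution $*:A\to A$ such that $(ab,c)=(b,a^*c)$ and $(ab,c)=(a,cb^* )$ for all $a,b,c$. A unitary commutative Frobenius algebra is a commutative $H^*$-algebra; its Frobenius form is $\epsilon(a)=(1,a)$. An isomorphism of $H^*$-algebras is a unitary map that is an involution-preserving algebra isomorphism. An $H^*$-category is a category enriched in finite-dimensional complex Hilbert spaces (with linear maps), with antilinear maps $*:\mathrm{Hom}(x,y)\to\mathrm{Hom}(y,x)$ such that $f^{**}=f$, $(fg)^*=g^*f^*$, $(fg,h)=(g,f^*h)$, $(fg,h)=(f,hg^* )$ whenever defined. A 2-Hilbert space is a Cauchy complete $H^*$-category (equivalently: finite direct sums exist and idempotents split); it is semisimple, and here has finitely many isomorphism classes of simple objects $e_i$, with scale factors $k_i=(\mathrm{id}_{e_i},\mathrm{id}_{e_i})>0$. $\mathrm{Dim}\,H=\mathrm{Nat}(\mathrm{id}_H,\mathrm{id}_H)$ is the algebra of natural transformations of the identity functor on $H$, with involution $\theta\mapsto\theta^*$ (componentwise), and inner product $\langle\theta,\theta'\rangle=\sum_ik_i(\theta_{e_i},\theta'_{e_i})$ over representative simple objects. *)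

(* Defs.v *)
From HB Require Import structures.
From mathcomp Require Import all_boot all_order all_algebra sesquilinear.
From mathcomp Require Import complex.
From mathcomp Require Import boolp reals.

Set Implicit Arguments.
Unset Strict Implicit.
Unset Printing Implicit Defensive.

Import GRing.Theory Num.Theory.
Local Open Scope ring_scope.

Section Hilbert.
Variable R : realType.

Record hilbert := Hilbert {
  hilbert_sort :> vectType R[i];
  hilbert_dot : {dot hilbert_sort for @Num.conj R[i]} }.

(* Library dot products are linear in the first argument; swapping the
   arguments gives an inner product that is linear in the second one. *)
Definition ip (V : hilbert) (u v : V) : R[i] := hilbert_dot V v u.

End Hilbert.

Section HStarAlgebra.
Variable R : realType.

(* The operations of an H*-algebra without their axioms. The library's algType
   is not used because it excludes the zero algebra. *)
Record hstar_data := HStarData {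
  hs_sort :> lmodType R[i];
  hs_mul : hs_sort -> hs_sort -> hs_sort;
  hs_one : hs_sort;
  hs_star : hs_sort -> hs_sort;
  hs_ip : hs_sort -> hs_sort -> R[i] }.

Record hstar_algebra := HStarAlgebra {
  ha_sort :> hilbert R;
  ha_mul : ha_sort -> ha_sort -> ha_sort;
  ha_one : ha_sort;
  ha_star : ha_sort -> ha_sort;
  ha_mulA : associative ha_mul;
  ha_mul1l : left_id ha_one ha_mul;
  ha_mul1r : right_id ha_one ha_mul;
  ha_mul_linearl : forall b, linear (ha_mul ^~ b);
  ha_mul_linearr : forall a, linear (ha_mul a);
  ha_star_antilinear : forall (c : R[i]) a b,
    ha_star (c *: a + b) = c^* *: ha_star a + ha_star b;
  ha_starK : involutive ha_star;
  ha_adjl : forall a b c, ip (ha_mul a b) c = ip b (ha_mul (ha_star a) c);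
  ha_adjr : forall a b c, ip (ha_mul a b) c = ip a (ha_mul c (ha_star b)) }.

Definition hstar_algebra_data (A : hstar_algebra) : hstar_data :=
  @HStarData A (@ha_mul A) (ha_one A) (@ha_star A) (@ip R A).

(* All of the structure is preserved, so if one side satisfies the axioms of
   an H*-algebra then so does the other. *)
Record is_hstar_iso (A B : hstar_data) (f : {linear A -> B}) : Prop := {
  hiso_bij : bijective f;
  hiso_mul : forall a b, f (hs_mul a b) = hs_mul (f a) (f b);
  hiso_one : f (hs_one A) = hs_one B;
  hiso_star : forall a, f (hs_star a) = hs_star (f a);
  hiso_unitary : forall a b, hs_ip (f a) (f b) = hs_ip a b }.

Definition hstar_isomorphic (A B : hstar_data) : Prop :=
  exists f : {linear A -> B}, is_hstar_iso f.

Record unitary_comm_frobenius := UnitaryCommFrobenius {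
  ucf_algebra :> hstar_algebra;
  ucf_mulC : commutative (@ha_mul ucf_algebra) }.

Definition frobenius_form (A : unitary_comm_frobenius) (a : A) : R[i] :=
  ip (ha_one A) a.

End HStarAlgebra.

Section HStarCategory.
Variable R : realType.

(* [comp f g] is "f after g". *)
Record hstar_category := HStarCategory {
  obj :> Type;
  Hom : obj -> obj -> hilbert R;
  idm : forall x, Hom x x;
  comp : forall x y z, Hom y z -> Hom x y -> Hom x z;
  dag : forall x y, Hom x y -> Hom y x;
  compA : forall w x y z (f : Hom y z) (g : Hom x y) (h : Hom w x),
    comp f (comp g h) = comp (comp f g) h;
  comp1m : forall x y (f : Hom x y), comp (idm y) f = f;
  compm1 : forall x y (f : Hom x y), comp f (idm x) = f;
  comp_linearl : forall x y z (g : Hom x y),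
    linear (fun f : Hom y z => comp f g);
  comp_linearr : forall x y z (f : Hom y z),
    linear (fun g : Hom x y => comp f g);
  dag_antilinear : forall x y (c : R[i]) (f g : Hom x y),
    dag (c *: f + g) = c^* *: dag f + dag g;
  dagK : forall x y (f : Hom x y), dag (dag f) = f;
  dag_comp : forall x y z (f : Hom y z) (g : Hom x y),
    dag (comp f g) = comp (dag g) (dag f);
  comp_adjl : forall x y z (f : Hom y z) (g : Hom x y) (h : Hom x z),
    ip (comp f g) h = ip g (comp (dag f) h);
  comp_adjr : forall x y z (f : Hom y z) (g : Hom x y) (h : Hom x z),
    ip (comp f g) h = ip f (comp h (dag g)) }.

Variable H : hstar_category.

Definition is_iso (x y : H) (f : Hom x y) : Prop :=
  exists g : Hom y x, comp g f = idm x /\ comp f g = idm y.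

Definition isomorphic (x y : H) : Prop := exists f : Hom x y, is_iso f.

Definition is_mono (x y : H) (f : Hom x y) : Prop :=
  forall (w : H) (g h : Hom w x), comp f g = comp f h -> g = h.

Definition is_zero_obj (x : H) : Prop := idm x = 0.

Definition is_simple (x : H) : Prop :=
  ~ is_zero_obj x /\
  forall (y : H) (m : Hom y x), is_mono m -> is_zero_obj y \/ is_iso m.

Definition is_direct_sum n (x : 'I_n -> H) (s : H)
    (i : forall j, Hom (x j) s) (p : forall j, Hom s (x j)) : Prop :=
  [/\ forall j, comp (p j) (i j) = idm (x j),
      forall j k, j != k -> comp (p j) (i k) = 0 &
      \sum_j comp (i j) (p j) = idm s].

(* [n = 0] gives a zero object. *)
Definition has_finite_direct_sums : Prop :=
  forall n (x : 'I_n -> H),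
    exists (s : H) (i : forall j, Hom (x j) s) (p : forall j, Hom s (x j)),
      is_direct_sum i p.

Definition idempotents_split : Prop :=
  forall (x : H) (e : Hom x x), comp e e = e ->
    exists (y : H) (i : Hom y x) (r : Hom x y), comp i r = e /\ comp r i = idm y.

Definition cauchy_complete : Prop :=
  has_finite_direct_sums /\ idempotents_split.

Definition representative_simples n (e : 'I_n -> H) : Prop :=
  [/\ forall j, is_simple (e j),
      forall j k, isomorphic (e j) (e k) -> j = k &
      forall x, is_simple x -> exists j, isomorphic x (e j)].

Definition finitely_many_simples : Prop :=
  exists n, exists e : 'I_n -> H, representative_simples e.

End HStarCategory.

Section Dim.
Variable R : realType.

Record two_hilbert := TwoHilbert {
  th_category :> hstar_category R;
  th_cauchy : cauchy_complete th_category;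
  th_simples : finitely_many_simples th_category }.

Variable H : two_hilbert.

(* A chosen family of representative simple objects. *)
Definition nsimples : nat := projT1 (cid (th_simples H)).

Definition simple_obj : 'I_nsimples -> H :=
  projT1 (cid (projT2 (cid (th_simples H)))).

Definition scale_factor (j : 'I_nsimples) : R[i] :=
  ip (idm (simple_obj j)) (idm (simple_obj j)).

(* Natural transformations from the identity functor of H to itself. *)
Record nat_end := NatEnd {
  component :> forall x : H, Hom x x;
  natural : forall (x y : H) (f : Hom x y),
    comp f (component x) = comp (component y) f }.

Lemma nat_endP (s t : nat_end) : (forall x, s x = t x) -> s = t.
Proof.
case: s t => [s sn] [t tn] /= st.
have e : s = t by apply: functional_extensionality_dep.
by move: sn tn; rewrite e => sn tn; rewrite (Prop_irrelevance sn tn).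
Qed.

Lemma comp0m (x y z : H) (g : Hom x y) : comp (0 : Hom y z) g = 0.
Proof.
have := comp_linearl g (-1) (0 : Hom y z) 0.
by rewrite scaler0 addr0 scaleN1r addNr.
Qed.

Lemma compm0 (x y z : H) (f : Hom y z) : comp f (0 : Hom x y) = 0.
Proof.
have := comp_linearr f (-1) (0 : Hom x y) 0.
by rewrite scaler0 addr0 scaleN1r addNr.
Qed.

Lemma compDl (x y z : H) (f f' : Hom y z) (g : Hom x y) :
  comp (f + f') g = comp f g + comp f' g.
Proof. by have := comp_linearl g 1 f f'; rewrite !scale1r. Qed.

Lemma compDr (x y z : H) (f : Hom y z) (g g' : Hom x y) :
  comp f (g + g') = comp f g + comp f g'.
Proof. by have := comp_linearr f 1 g g'; rewrite !scale1r. Qed.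

Lemma compZl (x y z : H) (c : R[i]) (f : Hom y z) (g : Hom x y) :
  comp (c *: f) g = c *: comp f g.
Proof. by have := comp_linearl g c f 0; rewrite !addr0 comp0m addr0. Qed.

Lemma compZr (x y z : H) (c : R[i]) (f : Hom y z) (g : Hom x y) :
  comp f (c *: g) = c *: comp f g.
Proof. by have := comp_linearr f c g 0; rewrite !addr0 compm0 addr0. Qed.

Fact nat_zero_subproof (x y : H) (f : Hom x y) : comp f 0 = comp 0 f.
Proof. by rewrite comp0m compm0. Qed.
Definition nat_zero := NatEnd nat_zero_subproof.

Fact nat_add_subproof (s t : nat_end) (x y : H) (f : Hom x y) :
  comp f (s x + t x) = comp (s y + t y) f.
Proof. by rewrite compDl compDr !natural. Qed.
Definition nat_add s t := NatEnd (@nat_add_subproof s t).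

Fact nat_scale_subproof (c : R[i]) (s : nat_end) (x y : H) (f : Hom x y) :
  comp f (c *: s x) = comp (c *: s y) f.
Proof. by rewrite compZl compZr natural. Qed.
Definition nat_scale c s := NatEnd (@nat_scale_subproof c s).

Fact nat_opp_subproof (s : nat_end) (x y : H) (f : Hom x y) :
  comp f (- s x) = comp (- s y) f.
Proof. by rewrite -(scaleN1r (s x)) -(scaleN1r (s y)) compZl compZr natural. Qed.
Definition nat_opp s := NatEnd (@nat_opp_subproof s).

Fact nat_one_subproof (x y : H) (f : Hom x y) :
  comp f (idm x) = comp (idm y) f.
Proof. by rewrite comp1m compm1. Qed.
Definition nat_one := NatEnd nat_one_subproof.

Fact nat_mul_subproof (s t : nat_end) (x y : H) (f : Hom x y) :
  comp f (comp (s x) (t x)) = comp (comp (s y) (t y)) f.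
Proof. by rewrite compA (natural s) -compA (natural t) compA. Qed.
Definition nat_mul s t := NatEnd (@nat_mul_subproof s t).

Fact nat_star_subproof (s : nat_end) (x y : H) (f : Hom x y) :
  comp f (dag (s x)) = comp (dag (s y)) f.
Proof. by rewrite -[f]dagK -!dag_comp natural. Qed.
Definition nat_star s := NatEnd (@nat_star_subproof s).

Definition nat_ip (s t : nat_end) : R[i] :=
  \sum_j scale_factor j * ip (s (simple_obj j)) (t (simple_obj j)).

HB.instance Definition _ := gen_eqMixin nat_end.
HB.instance Definition _ := gen_choiceMixin nat_end.

Fact nat_addA : associative nat_add.
Proof. by move=> s t u; apply: nat_endP => x; rewrite /= addrA. Qed.
Fact nat_addC : commutative nat_add.
Proof. by move=> s t; apply: nat_endP => x; rewrite /= addrC. Qed.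
Fact nat_add0 : left_id nat_zero nat_add.
Proof. by move=> s; apply: nat_endP => x; rewrite /= add0r. Qed.
Fact nat_addN : left_inverse nat_zero nat_opp nat_add.
Proof. by move=> s; apply: nat_endP => x; rewrite /= addNr. Qed.

HB.instance Definition _ :=
  GRing.isZmodule.Build nat_end nat_addA nat_addC nat_add0 nat_addN.

Fact nat_scaleA c d s : nat_scale c (nat_scale d s) = nat_scale (c * d) s.
Proof. by apply: nat_endP => x; rewrite /= scalerA. Qed.
Fact nat_scale1 : left_id 1 nat_scale.
Proof. by move=> s; apply: nat_endP => x; rewrite /= scale1r. Qed.
Fact nat_scaleDr : right_distributive nat_scale +%R.
Proof. by move=> c s t; apply: nat_endP => x; rewrite /= scalerDr. Qed.
Fact nat_scaleDl s : {morph nat_scale^~ s : c d / c + d}.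
Proof. by move=> c d; apply: nat_endP => x; rewrite /= scalerDl. Qed.

HB.instance Definition _ := GRing.Zmodule_isLmodule.Build R[i] nat_end
  nat_scaleA nat_scale1 nat_scaleDr nat_scaleDl.

Definition Dim : hstar_data R :=
  @HStarData R nat_end nat_mul nat_one nat_star nat_ip.

End Dim.

(* Main.v *)
From HB Require Import structures.
From mathcomp Require Import all_boot all_order all_algebra sesquilinear spectral.
From mathcomp Require Import complex boolp reals.
Require Import Defs.

(** Let A be a commutative H*-algebra. The inner product forbids nilpotents:
    if v <> 0 then v v* <> 0, because (v v*, 1) = (v, v) > 0. Multiplications
    by elements of A form a commuting family of operators, so every nonzero
    ideal contains a joint eigenvector v ([ideal_eigenvector]), and then v v*,
    once normalized, is a self-adjoint idempotent p for which A p is a line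
    ([exists_minimal_projection]). Splitting off such a p lowers the dimension
    of the ideal generated by the remaining idempotent, so the unit is a sum of
    finitely many orthogonal minimal projections p_i ([spectral_resolution]).
    Hence a is the sum of chi_i(a) p_i for characters chi_i of A, and A is the
    orthogonal direct sum of lines whose only invariants are the numbers
    (p_i, p_i) > 0 ([ip_characters]).

    For H take the skeletal 2-Hilbert space with n simple objects of arbitrary
    scale factors k_i > 0: an object is a family of dimensions (x_i), a morphism
    is a family of matrices, and (f, g) is the sum of the k_i tr(f_i^* g_i).
    Adjointness for this inner product is cyclicity of the trace; idempotents
    split by rank factorization. An object is simple exactly when one x_i is 1
    and the others are 0 ([simple_of_simple], [simpleP]), and a natural
    endomorphism of the identity acts on the i-th blocks of every object by one
    scalar c_i ([simple_valueK]).

    In Dim H the scale factor enters twice, once explicitly and once through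
    the inner product of End(e_i): the i-th idempotent of Dim H has square norm
    k_i^2 ([nat_ip_scalar]). So the choice k_i = sqrt (p_i, p_i) makes
    a |-> (chi_i(a))_i a unitary isomorphism from A to Dim H. *)

Set Implicit Arguments.
Unset Strict Implicit.
Unset Printing Implicit Defensive.

Import Order.TTheory GRing.Theory Num.Theory.
Local Open Scope ring_scope.

(** * Linear algebra *)

Section InnerProduct.
Variables (R : realType) (V : hilbert R).
Implicit Types u v w : V.

Lemma ip_conj u v : (ip u v)^* = ip v u.
Proof. by rewrite /ip [in RHS]hermC expr0 mul1r. Qed.

Lemma ip_gt0 u : u != 0 -> 0 < ip u u.
Proof. exact: neq0_dnorm_gt0. Qed.

Lemma ip0r u : ip u 0 = 0.
Proof. by rewrite /ip linear0l. Qed.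

Lemma ipDr u v w : ip u (v + w) = ip u v + ip u w.
Proof. by rewrite /ip linearDl. Qed.

Lemma ipZr c u v : ip u (c *: v) = c * ip u v.
Proof. by rewrite /ip linearZl. Qed.

Lemma ipZl c u v : ip (c *: u) v = c^* * ip u v.
Proof. by rewrite -ip_conj ipZr rmorphM /= ip_conj. Qed.

Lemma ip_sumr u I r (P : pred I) (v : I -> V) :
  ip u (\sum_(i <- r | P i) v i) = \sum_(i <- r | P i) ip u (v i).
Proof. by rewrite /ip linear_sumlz. Qed.

Lemma ip_inj u v : (forall w, ip w u = ip w v) -> u = v.
Proof.
move=> uv; apply/eqP; rewrite -subr_eq0; apply/negPn/negP => /ip_gt0.
by rewrite -scaleN1r ipDr ipZr uv mulN1r subrr ltxx.
Qed.

End InnerProduct.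

Section CommonEigenvector.
Import VectorInternalTheory.

(** Coordinates turn this into the existence of a common eigenvector for
    commuting complex matrices. *)
Lemma commuting_endo_eigenvector (C : numClosedFieldType) (V : vectType C)
    (I : finType) (f : I -> 'End(V)) :
  (\dim {:V} > 0)%N -> (forall i j x, f i (f j x) = f j (f i x)) ->
  exists2 v : V, v != 0 & forall i, exists c, f i v = c *: v.
Proof.
rewrite dimvf => V_gt0 f_comm.
pose As := [seq lin1_mx (v2r \o f i \o r2v) | i : I].
have [] := @common_eigenvector C (dim V) As V_gt0.
  move=> _ _ /imageP[i _ ->] /imageP[j _ ->].
  apply/row_matrixP => k; rewrite !rowE !mulmxA !mul_rV_lin1 /=.
  by rewrite !v2rK f_comm.
move=> r r0 /allP rP; exists (r2v r).
  by rewrite -(inj_eq (can_inj v2rK)) r2vK linear0.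
move=> i.
have /sub_rVP[c rc] :=
  rP _ (image_f (fun i => lin1_mx (v2r \o f i \o r2v)) (erefl : i \in I)).
by exists c; apply: (can_inj v2rK); rewrite linearZ /= r2vK -rc mul_rV_lin1.
Qed.

End CommonEigenvector.

(** Cancelling C on the left and D on the right in C (D C) D = C D. *)
Lemma idempotent_rank_factors (F : fieldType) m r
    (C : 'M[F]_(m, r)) (D : 'M[F]_(r, m)) :
  row_full C -> row_free D -> (C *m D) *m (C *m D) = C *m D -> D *m C = 1%:M.
Proof.
move=> C_full D_free CD; apply: (row_full_inj C_full).
by apply: (row_free_inj D_free); rewrite /= mulmx1 -[RHS]CD !mulmxA.
Qed.

(** The number of columns q is kept as a variable because it is instantiated by
    an expression that equals 1 without being convertible to it. *)
Lemma scalar_mx_of_left_mul (R : comNzRingType) m q (B : 'M[R]_m) c : q = 1%N ->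
  (forall F : 'M_(m, q), B *m F = c *: F) -> B = c%:M.
Proof.
move=> q1; subst q => BF; apply/matrixP => a b.
have /matrixP/(_ a 0) := BF (delta_mx b 0).
by rewrite -colE !mxE eqxx andbT mulr_natr.
Qed.

(** * Spectral theory of commutative H*-algebras *)

Section Algebra.
Variables (R : realType) (A : unitary_comm_frobenius R).
Implicit Types a b c u v p : A.
Local Notation "a ** b" := (ha_mul a b) (at level 40, left associativity).

HB.instance Definition _ a :=
  GRing.isLinear.Build R[i] A A *:%R (ha_mul a) (ha_mul_linearr a).

Lemma mulCA a b c : a ** (b ** c) = b ** (a ** c).
Proof. by rewrite !ha_mulA (ucf_mulC a). Qed.

Lemma mulZl k a b : (k *: a) ** b = k *: (a ** b).
Proof. by rewrite ucf_mulC linearZ /= ucf_mulC. Qed.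

Lemma mulDl a b c : (a + b) ** c = a ** c + b ** c.
Proof. by rewrite ucf_mulC linearD /= !(ucf_mulC c). Qed.

Lemma mulBl a b c : (a - b) ** c = a ** c - b ** c.
Proof. by rewrite ucf_mulC linearB /= !(ucf_mulC c). Qed.

(** Both sides are adjoint to multiplication by a b; commutativity removes the
    usual reversal of factors. *)
Lemma starM a b : ha_star (a ** b) = ha_star a ** ha_star b.
Proof.
apply: ip_inj => w.
rewrite -[ha_star _]ha_mul1r -[_ ** ha_star b]ha_mul1r -ha_adjl -!ha_mulA.
by rewrite -!ha_adjl mulCA ha_mulA.
Qed.

Lemma starZ k a : ha_star (k *: a) = k^* *: ha_star a.
Proof.
have star0 : ha_star 0 = 0 :> A.
  have := ha_star_antilinear (-1) (0 : A) 0.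
  by rewrite scaler0 addr0 rmorphN1 scaleN1r addNr.
by have := ha_star_antilinear k a 0; rewrite star0 !addr0.
Qed.

(** Absence of nilpotents: (v v*, 1) = (v, v). *)
Lemma star_mul_self_neq0 v : v != 0 -> v ** ha_star v != 0.
Proof.
move=> /ip_gt0; apply: contraTneq => h0.
by rewrite -[v in ip _ v]ha_mul1l -{2}[v]ha_starK -ha_adjr h0 -ip_conj ip0r
  conjC0 ltxx.
Qed.

Definition minimal_projection p :=
  [/\ p != 0, p ** p = p, ha_star p = p & forall a, exists k, a ** p = k *: p].

(** The ideal generated by u is stable under all multiplications, which commute;
    a common eigenvector for the multiplications by basis elements is one for
    every multiplication. *)
Lemma ideal_eigenvector u : u != 0 ->
  exists2 v, v != 0 & (exists a, v = u ** a) /\ forall b, exists k, b ** v = k *: v.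
Proof.
move=> u0; pose W := limg (linfun (ha_mul u)).
have WP x : reflect (exists a, x = u ** a) (x \in W).
  apply: (iffP memv_imgP) => [[a _ ->]|[a ->]]; exists a; rewrite ?lfunE //.
  exact: memvf.
have W_gt0 : (\dim {:subvs_of W} > 0)%N.
  rewrite dimvf lt0n dimv_eq0; apply: contraNneq u0 => W0.
  by rewrite -memv0 -W0; apply/WP; exists (ha_one A); rewrite ha_mul1r.
have W_ideal b (x : subvs_of W) : b ** vsval x \in W.
  by have /WP[a ->] := subvsP x; apply/WP; exists (b ** a); rewrite mulCA.
pose B := vbasis {:A}.
pose f i : 'End(subvs_of W) := linfun (vsproj W \o ha_mul B`_i \o vsval).
have fE i x : vsval (f i x) = B`_i ** vsval x.
  by rewrite lfunE /= vsprojK ?W_ideal.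
have [] := commuting_endo_eigenvector (f := fun i : 'I_(\dim {:A}) => f i) W_gt0.
  by move=> i j x; apply: val_inj; rewrite /= !fE mulCA.
move=> v v0 vP.
exists (vsval v); first by rewrite -(inj_eq val_inj) in v0.
split=> [|b]; first exact/WP/subvsP.
have [k kP] := fin_all_exists vP.
have {}kP (i : 'I_(\dim {:A})) : B`_i ** vsval v = k i *: vsval v by rewrite -fE kP.
exists (\sum_i coord B i b * k i).
rewrite {1}(coord_vbasis (memvf b)) ucf_mulC linear_sum scaler_suml.
by apply: eq_bigr => i _; rewrite linearZ /= ucf_mulC kP scalerA.
Qed.

(** For an eigenvector v the element h = v v* is self-adjoint and h h = m h.
    Here m <> 0 because h h* <> 0, and m is real because h h is self-adjoint;
    so p = h / m is a projection. *)
Lemma exists_minimal_projection u : u != 0 -> u ** u = u ->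
  exists2 p, minimal_projection p & u ** p = p.
Proof.
move=> u0 uu; have [v v0 [[a va] vP]] := ideal_eigenvector u0.
have uv : u ** v = v by rewrite va ha_mulA uu.
pose h := v ** ha_star v.
have h0 : h != 0 by exact: star_mul_self_neq0.
have h_star : ha_star h = h by rewrite /h starM ha_starK ucf_mulC.
have hP b : exists k, b ** h = k *: h.
  by have [k kE] := vP b; exists k; rewrite /h ha_mulA kE mulZl.
have [m hm] := hP h.
have m0 : m != 0.
  by apply: contraNneq (star_mul_self_neq0 h0) => m0; rewrite h_star hm m0 scale0r.
have m_real : m^* = m.
  have := hm; rewrite -{1 2}h_star -starM hm starZ h_star => /eqP.
  by rewrite -subr_eq0 -scalerBl scaler_eq0 (negPf h0) orbF subr_eq0 => /eqP.
exists (m^-1 *: h); first split.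
- by rewrite scaler_eq0 invr_eq0 (negPf m0).
- by rewrite mulZl linearZ /= hm !scalerA mulfVK.
- by rewrite starZ h_star fmorphV /= m_real.
- move=> b; have [k kE] := hP b; exists k.
  by rewrite linearZ /= kE !scalerA mulrC.
by rewrite linearZ /= /h ha_mulA uv.
Qed.

(** Induction on the dimension of u A: for a minimal projection p below u, the
    ideal generated by u - p does not contain p, so it is strictly smaller. The
    condition u p_i = p_i makes the later projections orthogonal to p. *)
Lemma sum_of_minimal_projections u : u ** u = u ->
  exists n (p : 'I_n -> A),
    [/\ forall i, minimal_projection (p i),
        forall i j, i != j -> p i ** p j = 0,
        forall i, u ** p i = p i &
        \sum_i p i = u].
Proof.
have [d] := ubnP (\dim (limg (linfun (ha_mul u)))).
elim: d u => // d IHd u; rewrite ltnS => u_d uu.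
have [->|u0] := eqVneq u 0.
  by exists 0, (fun=> 0); split=> [[]|[]|[]|] //; rewrite big_ord0.
have [p pmin up] := exists_minimal_projection u0 uu.
have [p0 pp _ _] := pmin.
have pu : p ** u = p by rewrite ucf_mulC.
pose w := u - p.
have pw : p ** w = 0 by rewrite linearB /= pu pp subrr.
have uw : u ** w = w by rewrite linearB /= uu up.
have ww : w ** w = w by rewrite {1}/w mulBl uw pw subr0.
have w_d : (\dim (limg (linfun (ha_mul w))) < d)%N.
  apply: leq_trans u_d; rewrite ltnNge; apply/negP => le_uw.
  have sub_wu : (limg (linfun (ha_mul w)) <= limg (linfun (ha_mul u)))%VS.
    apply/subvP => _ /memv_imgP[a _ ->]; apply/memv_imgP.
    by exists (w ** a); rewrite ?memvf // !lfunE /= ha_mulA uw.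
  have /eqP eq_wu : limg (linfun (ha_mul w)) == limg (linfun (ha_mul u)).
    by rewrite eqEdim sub_wu.
  have : p \in limg (linfun (ha_mul w)).
    by rewrite eq_wu; apply/memv_imgP; exists p; rewrite ?memvf // lfunE.
  case/memv_imgP => a _; rewrite lfunE /= => pE.
  by move: p0; rewrite -pp {2}pE ha_mulA pw ucf_mulC linear0 eqxx.
have [n [q [qmin qq wq qw]]] := IHd w w_d ww.
have pq i : p ** q i = 0 by rewrite -wq ha_mulA pw ucf_mulC linear0.
(* p is put at index 0, before the projections below u - p. *)
exists n.+1, (fun i => if unlift ord0 i is Some j then q j else p).
split=> [i|i j|i|].
- by case: unliftP.
- case: unliftP => [i'|] -> ; case: unliftP => [j'|] -> //.
  + by rewrite (inj_eq lift_inj) => /qq.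
  + by rewrite ucf_mulC pq.
- by case: unliftP => [i'|] _ //; rewrite -wq ha_mulA uw.
rewrite big_ord_recl unlift_none (eq_bigr q) ?qw ?subrKC // => i _.
by rewrite liftK.
Qed.

Lemma spectral_resolution :
  exists n (p : 'I_n -> A),
    [/\ forall i, minimal_projection (p i),
        forall i j, i != j -> p i ** p j = 0 &
        \sum_i p i = ha_one A].
Proof.
have [n [p [? ? _ ?]]] := sum_of_minimal_projections (ha_mul1l (ha_one A)).
by exists n, p.
Qed.

Section Characters.
Variables (n : nat) (p : 'I_n -> A).
Hypothesis p_min : forall i, minimal_projection (p i).
Hypothesis p_orth : forall i j, i != j -> p i ** p j = 0.
Hypothesis p_sum : \sum_i p i = ha_one A.

Definition weight i := ip (p i) (p i).

Lemma weight_gt0 i : 0 < weight i.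
Proof. by have [p0 _ _ _] := p_min i; apply: ip_gt0. Qed.

Lemma weight_neq0 i : weight i != 0.
Proof. by rewrite gt_eqF ?weight_gt0. Qed.

(** The eigenvalue of multiplication by a on the line of p i. *)
Definition character i a := ip (p i) (a ** p i) / weight i.

Lemma character_eigen i a : a ** p i = character i a *: p i.
Proof.
have [_ _ _ /(_ a)[k kE]] := p_min i.
by rewrite /character {2}kE ipZr mulfK ?weight_neq0.
Qed.

Lemma character_unique i a k : a ** p i = k *: p i -> character i a = k.
Proof. by rewrite /character => ->; rewrite ipZr mulfK ?weight_neq0. Qed.

Lemma character_linear i : scalar (character i).
Proof.
move=> k a b; apply: character_unique.
by rewrite mulDl mulZl !character_eigen scalerDl scalerA.
Qed.

Lemma characterM i a b : character i (a ** b) = character i a * character i b.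
Proof.
apply: character_unique.
by rewrite -ha_mulA character_eigen linearZ /= character_eigen scalerA mulrC.
Qed.

Lemma character1 i : character i (ha_one A) = 1.
Proof. by apply: character_unique; rewrite ha_mul1l scale1r. Qed.

(** By adjointness (p i, a* p i) = (a p i, p i). *)
Lemma character_star i a : character i (ha_star a) = (character i a)^*.
Proof.
rewrite /character -ha_adjl -ip_conj rmorphM /= fmorphV /=.
by rewrite [(weight i)^*]ip_conj.
Qed.

Lemma character_combination i (c : 'I_n -> R[i]) :
  character i (\sum_j c j *: p j) = c i.
Proof.
apply: character_unique; rewrite ucf_mulC linear_sum (bigD1 i) //=.
rewrite big1 ?addr0 => [|j ji]; rewrite linearZ /=.
  by have [_ -> _ _] := p_min i.
by rewrite p_orth 1?eq_sym // scaler0.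
Qed.

Lemma character_expansion a : a = \sum_i character i a *: p i.
Proof.
rewrite -[LHS]ha_mul1r -p_sum linear_sum.
by apply: eq_bigr => i _; apply: character_eigen.
Qed.

(** Since p i is a self-adjoint idempotent, (a, p i) = (a p i, p i), from which
    the conjugate of the character can be read off. *)
Lemma ip_characters a b :
  ip a b = \sum_i weight i * ((character i a)^* * character i b).
Proof.
rewrite {1}(character_expansion b) ip_sumr; apply: eq_bigr => i _.
have [_ pp pstar _] := p_min i.
rewrite ipZr -{1}pp -{2}pstar -ha_adjr character_eigen ipZl.
by rewrite mulrCA mulrA [RHS]mulrC.
Qed.

End Characters.

End Algebra.

(** * The 2-Hilbert space with given scale factors *)

Section GradedMatrices.
Variables (R : realType) (n : nat).
Implicit Types x y z : 'I_n -> nat.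

(** A morphism is stored as one function on all matrix entries rather than as a
    dependent family of blocks, so that finite functions provide its vector
    space structure. The blocks are recovered by [block]. *)
Definition entry x y : finType := {i : 'I_n & ('I_(y i) * 'I_(x i))%type}.
Definition gmx x y := {ffun entry x y -> (R[i] : numClosedFieldType)^o}.
HB.instance Definition _ x y := Vector.on (gmx x y).

Definition block x y i (f : gmx x y) : 'M[R[i]]_(y i, x i) :=
  \matrix_(a, b) f (Tagged (fun i => ('I_(y i) * 'I_(x i))%type) (a, b)).

Definition of_blocks x y (M : forall i, 'M[R[i]]_(y i, x i)) : gmx x y :=
  [ffun t => M (tag t) (tagged t).1 (tagged t).2].

Lemma block_of_blocks x y (M : forall i, 'M[R[i]]_(y i, x i)) i :
  block i (of_blocks M) = M i.
Proof. by apply/matrixP => a b; rewrite mxE ffunE. Qed.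

Lemma block_inj x y (f g : gmx x y) : (forall i, block i f = block i g) -> f = g.
Proof.
move=> fg; apply/ffunP => -[i [a b]].
by have /matrixP/(_ a b) := fg i; rewrite !mxE.
Qed.

Lemma block_linear x y i : linear (@block x y i).
Proof. by move=> c f g; apply/matrixP => a b; rewrite !mxE !ffunE. Qed.

HB.instance Definition _ x y i := GRing.isLinear.Build R[i] (gmx x y) _ *:%R
  (@block x y i) (block_linear i).

Lemma blockD x y (f g : gmx x y) i : block i (f + g) = block i f + block i g.
Proof. exact: (linearD (@block x y i)). Qed.
Lemma blockZ x y c (f : gmx x y) i : block i (c *: f) = c *: block i f.
Proof. exact: (linearZ_LR (@block x y i)). Qed.
Lemma block0 x y i : block i (0 : gmx x y) = 0.
Proof. exact: (linear0 (@block x y i)). Qed.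
Lemma block_sum x y (I : finType) (f : I -> gmx x y) i :
  block i (\sum_j f j) = \sum_j block i (f j).
Proof. exact: (linear_sum (@block x y i)). Qed.

Variable k : 'I_n -> R[i].
Hypothesis k_gt0 : forall i, 0 < k i.

Definition gmx_dot x y (f g : gmx x y) : R[i] :=
  \sum_t k (tag t) * (f t * (g t)^*).

Lemma gmx_dot_bilinear x y :
  bilinear_for *%R (Num.conj \; *%R) (@gmx_dot x y).
Proof.
have lin c (u v : gmx x y) t : (c *: u + v) t = c * u t + v t by rewrite !ffunE.
split=> [g|f] c u v; rewrite /gmx_dot /= mulr_sumr -big_split /=;
  apply: eq_bigr => t _; rewrite lin.
  by rewrite mulrDl mulrDr -[c * u t * _]mulrA (mulrCA (k _)).
by rewrite rmorphD rmorphM /= mulrDr mulrDr [f t * (_ * _)]mulrCA (mulrCA (k _)).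
Qed.

HB.instance Definition _ x y :=
  bilinear_isBilinear.Build R[i] (gmx x y) (gmx x y) R[i] *%R (Num.conj \; *%R)
    (@gmx_dot x y) (@gmx_dot_bilinear x y).

Lemma gmx_dot_hermitian x y (f g : gmx x y) :
  gmx_dot f g = (-1) ^+ false * (gmx_dot g f)^*.
Proof.
rewrite expr0 mul1r rmorph_sum; apply: eq_bigr => t _.
by rewrite !rmorphM /= conjCK (geC0_conj (ltW (k_gt0 _))) (mulrC (f t)).
Qed.

HB.instance Definition _ x y := isHermitianSesquilinear.Build R[i] (gmx x y) false
  (Num.conj : R[i] -> R[i]) (@gmx_dot x y) (@gmx_dot_hermitian x y).

Lemma gmx_dot_gt0 x y (f : gmx x y) : f != 0 -> 0 < gmx_dot f f.
Proof.
move=> f0; have ge0 t : 0 <= k (tag t) * (f t * (f t)^*).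
  by rewrite mulr_ge0 ?mul_conjC_ge0 ?ltW.
rewrite lt0r sumr_ge0 // andbT; apply: contra f0; rewrite psumr_eq0 // => /allP f0.
apply/eqP/ffunP => t; have := f0 t (mem_index_enum t).
by rewrite mulf_eq0 gt_eqF //= mul_conjC_eq0 ffunE => /eqP.
Qed.

HB.instance Definition _ x y := isDotProduct.Build R[i] (gmx x y)
  (@gmx_dot x y) (@gmx_dot_gt0 x y).

Definition gmx_hilbert x y : hilbert R :=
  Hilbert (@gmx_dot x y : {dot (gmx x y) for Num.conj}).

Local Notation "M ^H" := (map_mx Num.conj (M^T)) (at level 8, format "M ^H").

(** The form in which adjointness follows from cyclicity of the trace. *)
Lemma ip_blocks x y (f g : gmx_hilbert x y) :
  ip f g = \sum_i k i * \tr ((block i f)^H *m block i g).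
Proof.
transitivity (\sum_i \sum_(e : 'I_(y i) * 'I_(x i))
    k i * ((block i g) e.1 e.2 * ((block i f) e.1 e.2)^*)).
  rewrite (sig_big_dep xpredT (fun _ => xpredT)
    (fun i e => k i * ((block i g) e.1 e.2 * ((block i f) e.1 e.2)^* ))) //=.
  by apply: eq_bigr => -[i [a b]] _; rewrite !mxE.
apply: eq_bigr => i _; rewrite -mulr_sumr; congr (_ * _).
rewrite -(pair_bigA _ (fun a b => block i g a b * (block i f a b)^* )) exchange_big.
apply: eq_bigr => b _; rewrite mxE; apply: eq_bigr => a _.
by rewrite !mxE mulrC.
Qed.

Lemma adjmxM p q r (M : 'M[R[i]]_(p, q)) (N : 'M[R[i]]_(q, r)) :
  (M *m N)^H = N^H *m M^H.
Proof. by rewrite trmx_mul map_mxM. Qed.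

Lemma adjmxK p q (M : 'M[R[i]]_(p, q)) : (M^H)^H = M.
Proof. by apply/matrixP => a b; rewrite !mxE conjCK. Qed.

Definition gmx_id x : gmx_hilbert x x := of_blocks (fun i => 1%:M).
Definition gmx_comp x y z (f : gmx_hilbert y z) (g : gmx_hilbert x y) :
  gmx_hilbert x z := of_blocks (fun i => block i f *m block i g).
Definition gmx_dag x y (f : gmx_hilbert x y) : gmx_hilbert y x :=
  of_blocks (fun i => (block i f)^H).

Let blkE := (block_of_blocks, blockD, blockZ, block0, block_sum).

Fact gmx_compA w x y z (f : gmx_hilbert y z) (g : gmx_hilbert x y)
  (h : gmx_hilbert w x) : gmx_comp f (gmx_comp g h) = gmx_comp (gmx_comp f g) h.
Proof. by apply: block_inj => i; rewrite !blkE mulmxA. Qed.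

Fact gmx_comp1m x y (f : gmx_hilbert x y) : gmx_comp (gmx_id y) f = f.
Proof. by apply: block_inj => i; rewrite !blkE mul1mx. Qed.

Fact gmx_compm1 x y (f : gmx_hilbert x y) : gmx_comp f (gmx_id x) = f.
Proof. by apply: block_inj => i; rewrite !blkE mulmx1. Qed.

Fact gmx_comp_linearl x y z (g : gmx_hilbert x y) :
  linear (fun f : gmx_hilbert y z => gmx_comp f g).
Proof.
by move=> c f f'; apply: block_inj => i; rewrite !blkE mulmxDl -scalemxAl.
Qed.

Fact gmx_comp_linearr x y z (f : gmx_hilbert y z) :
  linear (fun g : gmx_hilbert x y => gmx_comp f g).
Proof.
by move=> c g g'; apply: block_inj => i; rewrite !blkE mulmxDr -scalemxAr.
Qed.

Fact gmx_dag_antilinear x y (c : R[i]) (f g : gmx_hilbert x y) :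
  gmx_dag (c *: f + g) = c^* *: gmx_dag f + gmx_dag g.
Proof.
by apply: block_inj => i; rewrite !blkE linearP map_mxD map_mxZ.
Qed.

Fact gmx_dagK x y (f : gmx_hilbert x y) : gmx_dag (gmx_dag f) = f.
Proof. by apply: block_inj => i; rewrite !blkE adjmxK. Qed.

Fact gmx_dag_comp x y z (f : gmx_hilbert y z) (g : gmx_hilbert x y) :
  gmx_dag (gmx_comp f g) = gmx_comp (gmx_dag g) (gmx_dag f).
Proof. by apply: block_inj => i; rewrite !blkE adjmxM. Qed.

Fact gmx_adjl x y z (f : gmx_hilbert y z) (g : gmx_hilbert x y)
    (h : gmx_hilbert x z) :
  ip (gmx_comp f g) h = ip g (gmx_comp (gmx_dag f) h).
Proof.
by rewrite !ip_blocks; apply: eq_bigr => i _; rewrite !blkE adjmxM mulmxA.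
Qed.

Fact gmx_adjr x y z (f : gmx_hilbert y z) (g : gmx_hilbert x y)
    (h : gmx_hilbert x z) :
  ip (gmx_comp f g) h = ip f (gmx_comp h (gmx_dag g)).
Proof.
rewrite !ip_blocks; apply: eq_bigr => i _.
by rewrite !blkE adjmxM mulmxA -mulmxA mxtrace_mulC.
Qed.

Definition gmx_category : hstar_category R :=
  HStarCategory gmx_compA gmx_comp1m gmx_compm1 gmx_comp_linearl
    gmx_comp_linearr gmx_dag_antilinear gmx_dagK gmx_dag_comp gmx_adjl gmx_adjr.

Local Notation H := gmx_category.

(** An idempotent e is C D for its rank factorization, through an object whose
    dimensions are the ranks of the blocks of e. *)
Lemma gmx_idempotents_split : idempotents_split H.
Proof.
move=> x e ee.
exists (fun i => \rank (block i e)), (of_blocks (fun i => col_base (block i e))).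
exists (of_blocks (fun i => row_base (block i e))).
split; apply: block_inj => i; rewrite !blkE ?mulmx_base //.
apply: (idempotent_rank_factors (col_base_full _) (row_base_free _)).
by rewrite !mulmx_base; have := congr1 (block i) ee; rewrite blkE.
Qed.

(** The inclusions and projections are the block columns and block rows of an
    identity matrix. *)
Lemma gmx_direct_sums : has_finite_direct_sums H.
Proof.
move=> m x; pose s : H := fun i => (\sum_j x j i)%N.
exists s, (fun j => of_blocks (fun i => submxrow (1%:M : 'M_(\sum_j x j i)) j)).
exists (fun j => of_blocks (fun i => submxcol (1%:M : 'M_(\sum_j x j i)) j)).
split=> [j|j l jl|]; apply: block_inj => i; rewrite !blkE.
- apply/matrixP => a b; rewrite mul_submxrow mulmx1 !mxE.
  by rewrite -val_eqE tagnat.eq_Rank eqxx.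
- rewrite mul_submxrow mulmx1; apply/matrixP => a b; rewrite !mxE.
  have [/(congr1 (@tagnat.sig1 _ _))|//] := eqVneq.
  by rewrite !tagnat.Rank1K => /eqP; rewrite (negPf jl).
under eq_bigr do rewrite !block_of_blocks.
rewrite -(mul_mxrow_mxcol (submxrow (1%:M : 'M_(\sum_j x j i)))
  (submxcol (1%:M : 'M_(\sum_j x j i)))).
by rewrite (submxrowK (1%:M : 'M_(\sum_j x j i))) submxcolK mulmx1.
Qed.

Lemma zero_objP (x : H) : is_zero_obj x <-> forall i, x i = 0%N.
Proof.
split=> [x0 i|x0].
  have /(congr1 (fun f => \rank (block i f))) := x0.
  by rewrite !blkE mxrank1 mxrank0.
apply: block_inj => i; rewrite !blkE.
by apply/matrixP => a; have := ltn_ord a; rewrite {2}x0.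
Qed.

(** Cancelling f against the inclusion of its own kernel suffices; for blocks
    acting on columns this kernel is [cokermx]. *)
Lemma monoP (x y : H) (f : Hom x y) :
  is_mono f <-> forall i, row_full (block i f).
Proof.
split=> [fm i|ff w g h fgh].
  rewrite -col_leq_rank -subn_eq0 -mxrank_coker mxrank_eq0; apply/eqP.
  pose g : gmx_hilbert x x := of_blocks (fun i => cokermx (block i f)).
  have -> : cokermx (block i f) = block i g by rewrite blkE.
  rewrite (fm x g 0) ?block0 //; apply: block_inj => j.
  by rewrite !blkE mulmx_coker mulmx0.
apply: block_inj => i; apply: (row_full_inj (ff i)).
by have := congr1 (block i) fgh; rewrite !blkE.
Qed.

(** The category is skeletal. *)
Lemma iso_dim (x y : H) : isomorphic x y -> x = y.
Proof.
case=> f [g [gf fg]]; apply/funext => i; apply/eqP; rewrite eqn_leq.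
have := congr1 (block i) gf; rewrite !blkE => /mulmx1_min ->.
by have := congr1 (block i) fg; rewrite !blkE => /mulmx1_min ->.
Qed.

Lemma mono_iso (x y : H) (f : Hom x y) : is_mono f -> x = y -> is_iso f.
Proof.
move=> /monoP ff xy; subst y.
exists (of_blocks (fun i => pinvmx (block i f))).
split; apply: block_inj => i; rewrite !blkE ?mulVpmx // mulmxVp //.
by have := ff i; rewrite /row_full /row_free.
Qed.

Definition simple_of (i : 'I_n) : H := fun j => (i == j : nat).

Lemma simple_of_neq0 i : ~ is_zero_obj (simple_of i).
Proof. by move=> /zero_objP /(_ i); rewrite /simple_of eqxx. Qed.

(** A monomorphism into [simple_of i] comes from an object with dimensions
    bounded by those of [simple_of i]: either all zero or the same. *)
Lemma simple_of_simple i : is_simple (simple_of i).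
Proof.
split=> [|y m mm]; first exact: simple_of_neq0.
have y_le j : (y j <= (i == j))%N.
  by have /monoP/(_ j)/eqP <- := mm; apply: rank_leq_row.
have [yi0|yi0] := eqVneq (y i) 0%N.
  left; apply/zero_objP => j; apply/eqP; have := y_le j.
  by have [<-|] := eqVneq i j; rewrite ?yi0 // leqn0.
right; apply: mono_iso mm _; apply/funext => j; apply/eqP.
rewrite eqn_leq y_le /simple_of /=.
by have [<-|//] := eqVneq i j; rewrite lt0n.
Qed.

(** If x i <> 0 then [simple_of i] embeds into x, and simplicity of x makes the
    embedding an isomorphism. *)
Lemma simpleP (x : H) : is_simple x -> exists i, x = simple_of i.
Proof.
move=> [x0 x_sub].
have /existsP[i xi] : [exists i, x i != 0%N].
  apply: contraT; rewrite negb_exists => /forallP x_eq0; case: x0.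
  by apply/zero_objP => i; apply/eqP/negPn/x_eq0.
exists i.
pose f : Hom (simple_of i) x := of_blocks (fun j => pid_mx (i == j)).
have f_mono : is_mono f.
  apply/monoP => j; rewrite blkE /row_full rank_pid_mx //.
  by have [<-|//] := eqVneq i j; rewrite lt0n.
by case: (x_sub _ _ f_mono) => [/simple_of_neq0//|f_iso]; apply/esym/iso_dim; exists f.
Qed.

Lemma gmx_representative_simples : representative_simples simple_of.
Proof.
split=> [|i j /iso_dim ij|x /simpleP[i ->]]; first exact: simple_of_simple.
  by have := congr1 (fun x => x j) ij; rewrite /simple_of eqxx; case: eqP.
exists i, (idm _), (idm _); by rewrite comp1m.
Qed.

Definition gmx_two_hilbert : two_hilbert R :=
  @TwoHilbert R H (conj gmx_direct_sums gmx_idempotents_split)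
    (ex_intro _ n (ex_intro _ _ gmx_representative_simples)).

(** * Natural endomorphisms of the identity *)

(** Dim is defined with a chosen family of representative simple objects; by
    skeletality any such family is a permutation of [simple_of]. *)
Lemma sum_representatives m (e : 'I_m -> H) (F : H -> R[i]) :
  representative_simples e -> \sum_j F (e j) = \sum_i F (simple_of i).
Proof.
case=> e_simple e_inj e_surj; have [_ simple_of_inj _] := gmx_representative_simples.
have [s sP] := fin_all_exists (fun j => simpleP (e_simple j)).
have [t tP] : exists t : 'I_n -> 'I_m, forall i, e (t i) = simple_of i.
  apply: (fin_all_exists (P := fun i j => e j = simple_of i)) => i.
  by have [j /iso_dim] := e_surj _ (simple_of_simple i); exists j.
have iso_refl (x y : H) : x = y -> isomorphic x y.
  by move=> <-; exists (idm x), (idm x); rewrite comp1m.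
rewrite [RHS](reindex s) /=; first by apply: eq_bigr => j _; rewrite sP.
exists t => [j _|i _].
  by apply/e_inj/iso_refl; rewrite tP sP.
by apply/simple_of_inj/iso_refl; rewrite -sP tP.
Qed.

Local Notation TH := gmx_two_hilbert.

Definition gmx_scalar (c : 'I_n -> R[i]) (x : TH) : Hom x x :=
  of_blocks (fun i => (c i)%:M).
Fact gmx_scalar_natural c (x y : TH) (f : Hom x y) :
  comp f (gmx_scalar c x) = comp (gmx_scalar c y) f.
Proof. by apply: block_inj => i; rewrite !blkE scalar_mxC. Qed.
Definition scalar_nat c : nat_end TH := NatEnd (@gmx_scalar_natural c).

(** The trace reads off the only entry of a block that is 1 by 1 only up to a
    propositional equality of dimensions. *)
Definition simple_value (s : nat_end TH) i := \tr (block i (s (simple_of i))).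

Lemma scalar_natK c : simple_value (scalar_nat c) =1 c.
Proof.
by move=> i; rewrite /simple_value blkE mxtrace_scalar /simple_of eqxx.
Qed.

(** Naturality against all morphisms from [simple_of i] to x, whose i-th blocks
    are arbitrary columns, forces the i-th block of s x to act as the scalar
    by which s acts on [simple_of i]. *)
Lemma simple_valueK s : scalar_nat (simple_value s) = s.
Proof.
apply: nat_endP => x; apply: block_inj => i; rewrite blkE; apply/esym.
have si1 : simple_of i i = 1%N by rewrite /simple_of eqxx.
apply: (scalar_mx_of_left_mul si1) => F.
have sE : block i (s (simple_of i)) = (simple_value s i)%:M.
  rewrite /simple_value; move: (block i _); rewrite si1 => B.
  by rewrite trace_mx11 -mx11_scalar.
have [f fE] : exists f : Hom (simple_of i : TH) x, block i f = F.
  (* F in block i and 0 elsewhere; the cast is needed only to state this. *)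
  exists (of_blocks (fun j => if i =P j is ReflectT ij then
    castmx (congr1 x ij, congr1 (simple_of i) ij) F else 0)).
  by rewrite blkE; case: eqP => // ii; rewrite (eq_irrelevance ii erefl) castmx_id.
have := congr1 (block i) (natural s f).
by rewrite !blkE fE sE mul_mx_scalar => ->.
Qed.

(** One factor k i is the scale factor, the other comes from the inner product
    on the endomorphisms of [simple_of i]. *)
Lemma nat_ip_scalar c d :
  nat_ip (scalar_nat c) (scalar_nat d) = \sum_i k i ^+ 2 * ((c i)^* * d i).
Proof.
have simple_ip a b i :
    ip (scalar_nat a (simple_of i)) (scalar_nat b (simple_of i)) =
    k i * ((a i)^* * b i).
  rewrite ip_blocks (bigD1 i) //= big1 ?addr0 => [|j ji]; rewrite !blkE.
    by rewrite tr_scalar_mx map_scalar_mx -scalar_mxM mxtrace_scalar /simple_of eqxx.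
  rewrite tr_scalar_mx map_scalar_mx -scalar_mxM mxtrace_scalar /simple_of.
  by rewrite eq_sym (negPf ji) mulr0n mulr0.
pose F (x : TH) := ip (idm x) (idm x) * ip (scalar_nat c x) (scalar_nat d x).
rewrite /nat_ip -[LHS]/(\sum_j F (simple_obj j)).
rewrite (sum_representatives F (projT2 (cid (projT2 (cid (th_simples TH)))))).
apply: eq_bigr => i _; rewrite /F simple_ip.
rewrite -[idm _]/(scalar_nat (fun=> 1) (simple_of i)) simple_ip.
by rewrite conjC1 !mulr1 mulrA expr2.
Qed.

End GradedMatrices.

(** * The isomorphism *)

Theorem proposition3p12 (R : realType) (A : unitary_comm_frobenius R) :
  exists H : two_hilbert R, hstar_isomorphic (hstar_algebra_data A) (Dim H).
Proof.
have [n [p [p_min p_orth p_sum]]] := spectral_resolution A.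
pose k i := sqrtC (weight p i).
have k_gt0 i : 0 < k i by rewrite sqrtC_gt0 weight_gt0.
pose H := gmx_two_hilbert k_gt0.
pose f (a : hstar_algebra_data A) : Dim H := scalar_nat k_gt0 (character p ^~ a).
have f_linear : linear f.
  move=> c a b; apply: nat_endP => x; apply: block_inj => i.
  rewrite blockD blockZ !block_of_blocks character_linear //.
  by rewrite scale_scalar_mx raddfD.
pose F : {linear hstar_algebra_data A -> Dim H} :=
  HB.pack f (GRing.isLinear.Build _ _ _ _ f f_linear).
exists H, F; split=> [|a b||a|a b].
- exists (fun s => \sum_i simple_value s i *: p i) => [a|s].
    rewrite [RHS](character_expansion p_min p_sum); apply: eq_bigr => i _.
    by rewrite scalar_natK.
  rewrite /= /f -[RHS]simple_valueK; congr scalar_nat; apply/funext => i.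
  exact: character_combination.
- apply: nat_endP => x; apply: block_inj => i.
  by rewrite !block_of_blocks characterM // scalar_mxM.
- apply: nat_endP => x; apply: block_inj => i.
  by rewrite !block_of_blocks character1.
- apply: nat_endP => x; apply: block_inj => i.
  by rewrite !block_of_blocks character_star // tr_scalar_mx map_scalar_mx.
rewrite [LHS]nat_ip_scalar [RHS](ip_characters p_min p_sum).
by apply: eq_bigr => i _; rewrite sqrtCK.
Qed.
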